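(* There are at least $2$ end points in the degeneration graph for quantum polynomial algebras in $6$ variables. That is, for $n=5$, there are at least two distinct nodes ($S_6$-orbits of subvarieties $\mathbb{V}(J)\subset\mathbb{T}_{2,5}$, $J\subset I$) whose dimension is $5$.
   Context: Let $n\ge 2$. Let $\mathbb{T}_{2,n}$ be the $\binom{n+1}{2}$-dimensional torus $(\mathbb{C}^* )^{\binom{n+1}{2}}$ with coordinate functions $(q_{ij})_{0\le i<j\le n}$. It parametrizes the quantum polynomial algebras $\mathbb{C}\langle x_0,\dots,x_n\rangle/(x_ix_j-q_{ij}x_jx_i)$ on $n+1$ variables, with the convention $q_{ii}=1$, $q_{ji}=q_{ij}^{-1}$. Put $b_{ijk}=q_{ij}q_{jk}q_{ik}^{-1}$ for $0\le i<j<k\le n$ and let $I=\{b_{ijk}-1\mid 0\le i<j<k\le n\}$. For each $J\subset I$ let $\mathbb{V}(J)\subset\mathbb{T}_{2,n}$ be the common zero locus of $J$ (a closed algebraic subgroup of $\mathbb{T}_{2,n}$); it may happen that $\mathbb{V}(J)=\mathbb{V}(K)$ with $J\ne K$. The group $S_{n+1}$ acts on $\mathbb{T}_{2,n}$ by permuting the variables of the quantum polynomial algebras, i.e. by permuting the indices of the $q_{ij}$, and this action permutes the subvarieties $\mathbb{V}(J)$. The degeneration graph has as nodes the subvarieties $\mathbb{V}(J)$, $J\subset I$, taken up to this $S_{n+1}$-action, with an arrow $\mathbb{V}(J)\to\mathbb{V}(K)$ if $\mathbb{V}(K)\subset\mathbb{V}(J)$. Each $\mathbb{V}(J)$ has dimension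 at least $n$, because the $n$-dimensional torus which is the kernel of the homomorphism $(q_{ij})\mapsto(b_{ijk})$ acts freely on it. An end point of the graph is a node of the minimal possible dimension $n$, i.e. an $n$-dimensional family of quantum polynomial algebras. *)

(* Defs.v *)
(* The complex numbers are R[i] for R : realType. *)
From mathcomp Require Import all_boot all_order all_algebra all_fingroup.
From mathcomp Require Import boolp classical_sets reals complex.
From mathcomp Require mpoly.

Set Implicit Arguments.
Unset Strict Implicit.
Unset Printing Implicit Defensive.

Import Order.TTheory GRing.Theory Num.Theory.
Local Open Scope classical_set_scope.
Local Open Scope ring_scope.

Definition pair_index (n : nat) : finType :=
  {p : 'I_n.+1 * 'I_n.+1 | (p.1 < p.2)%N}.

Definition triple_index (n : nat) : finType :=
  {t : 'I_n.+1 * 'I_n.+1 * 'I_n.+1 | (t.1.1 < t.1.2 < t.2)%N}.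

(* Tuples (q_ij) for 0 <= i < j <= n; the torus is the set of those with
   nonzero entries, and all subvarieties are sets of such tuples. *)
Definition qtuple (R : realType) (n : nat) : Type :=
  {ffun pair_index n -> R[i]}.

Definition torus (R : realType) (n : nat) : set (qtuple R n) :=
  [set q | forall p, q p != 0].

(* q_ij for arbitrary i, j: q_ii = 1 and q_ji = q_ij^-1. *)
Definition qentry (R : realType) (n : nat) (q : qtuple R n)
    (i j : 'I_n.+1) : R[i] :=
  if insub (i, j) is Some p then q p
  else if insub (j, i) is Some p then (q p)^-1
  else 1.

Definition bfun (R : realType) (n : nat) (t : triple_index n)
    (q : qtuple R n) : R[i] :=
  let: (i, j, k) := val t in
  qentry q i j * qentry q j k * (qentry q i k)^-1.

(* A subset of { b_ijk - 1 } is given by the set J of its indices (i, j, k). *)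
Definition VJ (R : realType) (n : nat) (J : {set triple_index n}) :
    set (qtuple R n) :=
  [set q | torus q /\ forall t, t \in J -> bfun t q - 1 = 0].

Arguments VJ R {n} J.

(* In terms of the variables x_(s i) the relations read
   x_(s i) x_(s j) = q_(s i)(s j) x_(s j) x_(s i). *)
Definition permute (R : realType) (n : nat) (s : 'S_n.+1) (q : qtuple R n) :
    qtuple R n :=
  [ffun p : pair_index n => qentry q (s (val p).1) (s (val p).2)].

(* Zariski closed subsets of the torus. The inverses of the coordinates are not
   needed: a Laurent polynomial has the same zeros in the torus as its product
   with a suitable monomial. *)
Definition zariski_closed (R : realType) (n : nat) (Z : set (qtuple R n)) :
    Prop :=
  exists S : set (mpoly.mpoly #|pair_index n| R[i]),
    Z = [set q | torus q /\
           forall f, S f -> mpoly.meval (fun k => q (enum_val k)) f = 0].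

Definition irreducible_closed (R : realType) (n : nat)
    (Z : set (qtuple R n)) : Prop :=
  [/\ zariski_closed Z, Z !=set0 &
      forall A B : set (qtuple R n), zariski_closed A -> zariski_closed B ->
        Z `<=` A `|` B -> Z `<=` A \/ Z `<=` B].

Definition has_chain (R : realType) (n : nat) (Z : set (qtuple R n))
    (m : nat) : Prop :=
  exists F : nat -> set (qtuple R n),
    (forall i, (i <= m)%N -> irreducible_closed (F i) /\ F i `<=` Z) /\
    (forall i, (i < m)%N -> F i `<` F i.+1).

(* Krull dimension: closed subsets of the closed set Z are the closed subsets
   of the torus contained in Z. *)
Definition has_dim (R : realType) (n : nat) (Z : set (qtuple R n))
    (d : nat) : Prop :=
  has_chain Z d /\ forall m, has_chain Z m -> (m <= d)%N.

(* The node of V(J) is its orbit under the symmetric group. *)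
Definition node_of (R : realType) (n : nat) (J : {set triple_index n}) :
    set (set (qtuple R n)) :=
  [set X | exists s : 'S_n.+1, X = [set permute s q | q in VJ R J]].

Arguments node_of R {n} J.

(* The dimension does not depend on the chosen representative, since the group
   acts by automorphisms of the torus. *)
Definition end_point (R : realType) (n : nat)
    (N : set (set (qtuple R n))) : Prop :=
  exists J : {set triple_index n}, N = node_of R J /\ has_dim (VJ R J) n.

(* Main.v *)
Require Import Defs.
From mathcomp Require Import all_boot all_order all_algebra all_fingroup.
From mathcomp Require Import boolp classical_sets reals complex.
From mathcomp Require Import zify ring.
From mathcomp Require mpoly.
Import -(notations) mpoly.

Set Implicit Arguments.
Unset Strict Implicit.
Unset Printing Implicit Defensive.

Import Order.TTheory GRing.Theory Num.Theory.
Local Open Scope classical_set_scope.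
Local Open Scope ring_scope.

(** The proof exhibits two end points that differ by torsion.

Put t_j = q_0j, so t_0 = 1, and consider the cosets
T_c = { q | t_a q_ab = c_ab t_b } of the torus T = T_1 of all points
q_ab = t_b / t_a.  The vanishing of all b_ijk - 1 says that q is a
multiplicative 1-cocycle on the full simplex, that is V(I) = T.  More generally
a set J of triples, together with all edges, forms a simplicial complex, and
V(J) is the group of its 1-cocycles with values in the nonzero complex numbers.  The second
end point comes from the 6-vertex triangulation of the real projective plane,
which has all 15 edges and 10 of the 20 triangles.  Its first cohomology with
these coefficients is Hom(Z/2, C^* ), of order 2, and its 1-coboundaries form
T; hence V(J) is the union of T and of one other coset T_c with signs c_ab
([VJ_rp2_sub]).  The point c of that coset violates b_013 = 1, whereas this
equation holds on every permuted copy of T, so the two nodes differ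
([nodes_neq]).

It remains to see that a closed set which contains T and is covered by two
cosets T_c has Krull dimension n ([has_dim_two_cosets]).

Lower bound: setting the last coordinates t_j to 1 gives a chain of n + 1
subtori.  Each is irreducible: two of its points are joined by a line in the
coordinates t, and polynomials that are nonzero at one or the other end are
simultaneously nonzero at some point of this line.

Upper bound: on T_c every polynomial in the q_ab becomes a Laurent polynomial in
the n coordinates t_j, so a chain of irreducible closed sets in T_c yields a
chain of prime ideals in the polynomial ring in n variables
([coset_chain_length]).  If it had n + 1 strict inclusions, choose f_i in the
i-th ideal but not in the (i+1)-st.  By counting monomials the n + 1 polynomials
f_i satisfy a nontrivial relation ([algebraic_dependence]); but choosing the
lowest exponents successively, from the last f_i to the first, and cancelling
powers of f_i outside the ideals where they do not belong, one reduces such a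
relation to a nonzero constant in a prime ideal ([chain_independence]). *)

(** * Algebraic dependence of n + 1 polynomials in n variables *)

Local Notation mvar i := (mpolyX _ (mnm1 i)).

Lemma msizeM_pred_le (F : fieldType) n (p q : mpoly n F) :
  (msize (p * q) <= (msize p + msize q).-1)%N.
Proof.
have [->|p0] := eqVneq p 0; first by rewrite mul0r msize0.
have [->|q0] := eqVneq q 0; first by rewrite mulr0 msize0.
by rewrite (@msizeM _ F).
Qed.

Lemma msize_expr_le (F : fieldType) n (p : mpoly n F) d k :
  (msize p <= d.+1)%N -> (msize (p ^+ k) <= (k * d).+1)%N.
Proof.
move=> sp; elim: k => [|k IH]; first by rewrite expr0 msize1.
by rewrite exprS; have := msizeM_pred_le p (p ^+ k); rewrite mulSn; lia.
Qed.

Lemma msize_prod_le (F : fieldType) n I (r : seq I) (p : I -> mpoly n F) d :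
  (forall i, msize (p i) <= d.+1)%N ->
  (msize (\prod_(i <- r) p i) <= (size r * d).+1)%N.
Proof.
move=> sp; elim: r => [|i r IH]; first by rewrite big_nil msize1.
rewrite big_cons [size _]/= mulSn; apply: leq_trans (msizeM_pred_le _ _) _.
by have := sp i; lia.
Qed.

Lemma linear_dependence (F : fieldType) (T U : finType) (a : T -> U -> F) :
  (#|U| < #|T|)%N ->
  exists c : T -> F,
    (exists s, c s != 0) /\ forall u, \sum_s c s * a s u = 0.
Proof.
move=> ltUT.
pose A := \matrix_(i < #|T|, j < #|U|) a (enum_val i) (enum_val j).
have /rowV0Pn [v /sub_kermxP vA v0] : kermx A != 0.
  rewrite -mxrank_eq0 mxrank_ker -lt0n subn_gt0.
  exact: leq_ltn_trans (rank_leq_col A) ltUT.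
exists (fun s => v ord0 (enum_rank s)); split.
  have [j vj] : exists j, v ord0 j != 0 by apply/rV0Pn.
  by exists (enum_val j); rewrite enum_valK.
move=> u; move/matrixP/(_ ord0 (enum_rank u)): vA; rewrite !mxE => vA.
rewrite -[RHS]vA [RHS](reindex (@enum_rank T)) /=; last first.
  exact/onW_bij/enum_rank_bij.
by apply: eq_bigr => s _; rewrite mxE !enum_rankK.
Qed.

(** Products of the f i with all exponents below E number E ^ n.+1, while their
degree, hence the exponents of their monomials, grows linearly in E, so that
they lie in a space of dimension O(E ^ n).  For large E they are linearly
dependent. *)
Lemma algebraic_dependence (F : fieldType) n (f : nat -> mpoly n F) :
  exists E (c : {ffun 'I_n.+1 -> 'I_E} -> F),
    (exists s, c s != 0) /\
    \sum_s c s *: \prod_(i < n.+1) f i ^+ s i = 0.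
Proof.
pose D := (\max_(i < n.+1) msize (f i))%N.
(* The bound M on the sizes of the products is at most K * E, and E is chosen
   so that (K * E) ^ n < E ^ n.+1. *)
pose K := (n.+1 * D).+1; pose E := (K ^ n).+1; pose M := (n.+1 * (E * D)).+1.
pose P (s : {ffun 'I_n.+1 -> 'I_E}) : mpoly n F := \prod_(i < n.+1) f i ^+ s i.
have sP s : (msize (P s) <= M)%N.
  rewrite /M -[X in (X * _)%N](size_enum_ord n.+1).
  rewrite /P -big_enum; apply: msize_prod_le => i.
  apply: leq_trans (_ : (s i * D).+1 <= _)%N.
    apply: msize_expr_le; apply: leqW.
    exact: (leq_bigmax (F := fun i : 'I_n.+1 => msize (f i)) i).
  by rewrite ltnS leq_mul2r ltnW ?orbT.
have leMKE : (M <= K * E)%N by rewrite /M /K mulSn; nia.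
have ltUT : (#|{: {ffun 'I_n -> 'I_M}}| < #|{: {ffun 'I_n.+1 -> 'I_E}}|)%N.
  rewrite !card_ffun !card_ord expnS.
  apply: leq_ltn_trans (_ : (K * E) ^ n < _)%N; last first.
    by rewrite expnMn ltn_mul2r expn_gt0 ltnSn.
  by case: (n) => // k; rewrite leq_exp2r.
have [c [c0 cP]] := linear_dependence
  (fun s (u : {ffun 'I_n -> 'I_M}) =>
     mcoeff (Multinom [tuple val (u i) | i < n]) (P s)) ltUT.
exists E, c; split=> //; apply/mpolyP => m; rewrite mcoeff0.
have [ltm|gem] := ltnP (mdeg m) M.
  have mM i : (m i < M)%N.
    by apply: leq_ltn_trans ltm; rewrite mdegE (bigD1 i) //= leq_addr.
  rewrite -[RHS](cP [ffun i => Ordinal (mM i)]) raddf_sum /=.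
  apply: eq_bigr => s _; rewrite mcoeffZ; congr (_ * mcoeff _ _).
  by apply/mnmP => i; rewrite mnmE ffunE.
rewrite raddf_sum /= big1 // => s _; rewrite mcoeffZ memN_msupp_eq0 ?mulr0 //.
by apply: msize_mdeg_ge; apply: leq_trans (sP s) gem.
Qed.

(** * Chains of prime ideals *)

(** A predicate in Prop rather than a boolean one, because the ideals of
interest consist of the polynomials vanishing on an arbitrary set of points. *)
Record prime_ideal (A : comNzRingType) (P : A -> Prop) : Prop := PrimeIdeal {
  prime_ideal0 : P 0;
  prime_idealD : forall a b, P a -> P b -> P (a + b);
  prime_idealMl : forall a b, P b -> P (a * b);
  prime_ideal1 : ~ P 1;
  prime_idealM : forall a b, P (a * b) -> P a \/ P b
}.

Lemma prime_ideal_sum (A : comNzRingType) (P : A -> Prop) I (r : seq I)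
    (S : pred I) (a : I -> A) :
  prime_ideal P -> (forall i, S i -> P (a i)) ->
  P (\sum_(i <- r | S i) a i).
Proof. by move=> PP Pa; apply: (big_ind P) => //; case: PP. Qed.

Lemma prime_idealX (A : comNzRingType) (P : A -> Prop) a k :
  prime_ideal P -> P (a ^+ k) -> P a.
Proof.
move=> PP; elim: k => [|k IH]; first by rewrite expr0 => /(prime_ideal1 PP).
by rewrite exprS => /(prime_idealM PP) [].
Qed.

(** By induction on k.  Among the monomials indexed by S take the lowest
exponent of the last f; the corresponding power of f can be cancelled because f
is outside the prime ideal P k.+1.  The quotient lies in P k, which contains f,
so the terms still divisible by f can be dropped, and there remains a relation
in P k between monomials in the first k of the f i.  When no f is left,
injectivity of the exponents leaves at most one term, a nonzero constant, and
P 0 is a proper ideal. *)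
Lemma chain_independence (F : fieldType) (A : comAlgType F)
    (P : nat -> A -> Prop) (f : nat -> A) k
    (T : finType) (e : T -> nat -> nat) (c : T -> F) (S : {set T}) :
  (forall i, (i <= k)%N -> prime_ideal (P i)) ->
  (forall i a, (i < k)%N -> P i.+1 a -> P i a) ->
  (forall i, (i < k)%N -> P i (f i) /\ ~ P i.+1 (f i)) ->
  {in S &, forall s t, (forall i, (i < k)%N -> e s i = e t i) -> s = t} ->
  {in S, forall s, c s != 0} ->
  P k (\sum_(s in S) c s *: \prod_(i < k) f i ^+ e s i) -> S = finset.set0.
Proof.
elim: k S => [|k IH] S primeP subP Pf injS cS PS.
  apply/setP => s; rewrite inE; apply/negP => sS.
  have S1 t : (t \in S) = (t == s).
    by apply/idP/eqP => [tS|-> //]; apply: injS.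
  apply: (prime_ideal1 (primeP 0%N isT)).
  move: PS; rewrite (big_pred1 s) // big_ord0.
  move/(prime_idealMl (primeP 0%N isT) (c s)^-1%:A).
  by rewrite -scalerAl mul1r scalerA mulVf ?scale1r // cS.
have [//|[s0 s0S]] := set_0Vmem S.
case: (arg_minnP (fun s => e s k) s0S) => s1 S1 s1min.
have s1S : s1 \in S by [].
(* The terms with the lowest exponent of f k, attained at s1. *)
pose S' := finset (fun s => (s \in S) && (e s k == e s1 k)).
have S'E s : (s \in S') = (s \in S) && (e s k == e s1 k) by rewrite inE.
have Pk := primeP k (leqnSn k); have Pk1 := primeP k.+1 (leqnn _).
have [fk fk1] := Pf k (ltnSn k).
pose g s := c s *: \prod_(i < k) f i ^+ e s i.
have PS1 : P k (\sum_(s in S) g s * f k ^+ (e s k - e s1 k)).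
  apply: subP => //; move: PS.
  have -> : \sum_(s in S) c s *: \prod_(i < k.+1) f i ^+ e s i =
      f k ^+ e s1 k * \sum_(s in S) g s * f k ^+ (e s k - e s1 k).
    rewrite mulr_sumr; apply: eq_bigr => s sS.
    rewrite mulrCA -exprD subnKC ?s1min //.
    by rewrite /g big_ord_recr /= scalerAl.
  by case/(prime_idealM Pk1) => // /(prime_idealX Pk1).
suff S'0 : S' = finset.set0.
  by have := S'E s1; rewrite S'0 finset.in_set0 s1S eqxx.
apply: (IH S').
- by move=> i ik; apply: primeP; apply: leqW.
- by move=> i a ik; apply: subP; apply: leqW.
- by move=> i ik; apply: Pf; apply: leqW.
- move=> s t; rewrite !S'E => /andP [sS /eqP es] /andP [tS /eqP et] st.
  apply: injS => // i; rewrite ltnS leq_eqVlt => /predU1P [->|/st //].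
  by rewrite es et.
- by move=> s; rewrite S'E => /andP [/cS].
have -> : \sum_(s in S') c s *: \prod_(i < k) f i ^+ e s i =
    \sum_(s in S) g s * f k ^+ (e s k - e s1 k) +
    -1 * \sum_(s in S | e s k != e s1 k) g s * f k ^+ (e s k - e s1 k).
  rewrite [X in _ = X + _](bigID (fun s => e s k == e s1 k)) /= mulN1r addrK.
  apply: eq_big => [s|s]; first by rewrite S'E.
  by rewrite S'E => /andP [_ /eqP ->]; rewrite subnn expr0 mulr1.
apply: prime_idealD => //; apply: prime_idealMl => //.
apply: prime_ideal_sum => // s /andP [sS es].
rewrite -(@subnK 1 (e s k - e s1 k)); last first.
  by rewrite subn_gt0 ltn_neqAle eq_sym es s1min.
by rewrite addn1 exprSr mulrA; apply: prime_idealMl.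
Qed.

Lemma no_long_prime_chain (F : fieldType) n (P : nat -> mpoly n F -> Prop) :
  (forall i, (i <= n.+1)%N -> prime_ideal (P i)) ->
  (forall i p, (i <= n)%N -> P i.+1 p -> P i p) ->
  (forall i, (i <= n)%N -> exists p, P i p /\ ~ P i.+1 p) -> False.
Proof.
move=> primeP subP strictP.
have /choice [f Pf] : forall i, exists p, (i <= n)%N -> P i p /\ ~ P i.+1 p.
  move=> i; case: (leqP i n) => [/strictP [p]|]; [by exists p | by exists 0].
have [E [c [[s cs] csum]]] := algebraic_dependence f.
pose e (t : {ffun 'I_n.+1 -> 'I_E}) i : nat := t (inord i).
suff : finset (fun t => c t != 0) = finset.set0.
  by move/setP/(_ s); rewrite !inE cs.
apply: (chain_independence (P := P) (f := f) (k := n.+1) (e := e) (c := c)) => //.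
- move=> t u _ _ tu; apply/ffunP => i; apply: val_inj.
  by have := tu i (ltn_ord i); rewrite /e inord_val.
- by move=> t; rewrite inE.
suff -> : \sum_(t in finset (fun t => c t != 0))
    c t *: \prod_(i < n.+1) f i ^+ e t i = 0.
  exact: (prime_ideal0 (primeP n.+1 (leqnn _))).
rewrite -[RHS]csum; symmetry; rewrite (bigID (fun t => c t != 0)) /=.
rewrite [X in _ + X]big1 ?addr0; last first.
  by move=> t; rewrite negbK => /eqP ->; rewrite scale0r.
apply: eq_big => [t|t _]; first by rewrite inE.
by congr (_ *: _); apply: eq_bigr => i _; rewrite /e inord_val.
Qed.

(** * Nonvanishing along a line *)

(** On the line through x and z the two polynomials become univariate and
nonzero, and their product has a nonroot because the field is infinite. *)
Lemma line_avoids_zeros (F : closedFieldType) n (g h : mpoly n F)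
    (x z : 'I_n -> F) :
  meval x g != 0 -> meval z h != 0 ->
  exists s, meval (fun i => x i + s * (z i - x i)) g != 0 /\
            meval (fun i => x i + s * (z i - x i)) h != 0.
Proof.
move=> gx hz.
pose on_line (k : mpoly n F) : {poly F} :=
  mmap polyC (fun i => (x i)%:P + 'X * (z i - x i)%:P) k.
have lineE k s : (on_line k).[s] = meval (fun i => x i + s * (z i - x i)) k.
  rewrite mevalE horner_sum; apply: eq_bigr => m _.
  rewrite hornerM hornerC horner_prod; congr (_ * _); apply: eq_bigr => i _.
  by rewrite horner_exp !hornerE.
have line0 k s : meval (fun i => x i + s * (z i - x i)) k != 0 -> on_line k != 0.
  by apply: contra_neq => k0; rewrite -lineE k0 horner0.
have /closed_nonrootP [s] : on_line g * on_line h != 0.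
  rewrite mulf_neq0 //.
    by apply: (line0 g 0); rewrite (meval_eq (v2 := x)) // => i;
      rewrite mul0r addr0.
  by apply: (line0 h 1); rewrite (meval_eq (v2 := z)) // => i;
    rewrite mul1r addrC subrK.
rewrite rootM negb_or !rootE !lineE => /andP [gs hs].
by exists s.
Qed.

(** * Cosets of the diagonal torus: upper bound for the dimension *)

Section Torus.

Variables (R : realType) (n : nat).
Local Notation C := R[i].
Implicit Types (q : qtuple R n) (c : pair_index n -> C) (p : pair_index n).

Lemma qentry_pair q p : qentry q (val p).1 (val p).2 = q p.
Proof.
by rewrite /qentry; case: p => [[a b] ab] /=; rewrite insubT.
Qed.

Lemma qentry_diag q a : qentry q a a = 1.
Proof. by rewrite /qentry insubF //= ltnn. Qed.

Lemma qentry_sym q a b : qentry q b a = (qentry q a b)^-1.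
Proof.
have [ab|ba|/val_inj ->] := ltngtP (val a) (val b).
- by rewrite /qentry insubF ?insubT //= ltnNge ltnW.
- by rewrite /qentry insubT // insubF ?invrK //= ltnNge ltnW.
- by rewrite qentry_diag invr1.
Qed.

Lemma qentry_neq0 q a b : torus q -> qentry q a b != 0.
Proof.
move=> tq; rewrite /qentry; case: insub => [p|]; first exact: tq.
by case: insub => [p|]; [rewrite invr_eq0; apply: tq | exact: oner_neq0].
Qed.

Definition row0 q (j : 'I_n.+1) : C := qentry q ord0 j.

Definition coords q (i : 'I_n) : C := row0 q (lift ord0 i).

(** The numbering of the coordinates by ordinals is that of [zariski_closed]. *)
Definition eval_at q (f : mpoly #|pair_index n| C) : C :=
  meval (fun k => q (enum_val k)) f.

(** The coset of the torus q_ab = t_b / t_a by the point c, written as equations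
in which t_j stands for q_0j; for c = 1 it is the torus itself.  The coset is
empty unless c_0j = 1 for all j. *)
Definition coset_torus c : set (qtuple R n) :=
  [set q | torus q /\
    forall p, row0 q (val p).1 * q p = c p * row0 q (val p).2].

Definition row0_poly (j : 'I_n.+1) : mpoly #|pair_index n| C :=
  if insub (ord0, j) is Some p then mvar (enum_rank (p : pair_index n)) else 1.

Lemma eval_at_var q p : eval_at q (mvar (enum_rank p)) = q p.
Proof. by rewrite /eval_at mevalXU enum_rankK. Qed.

Lemma eval_row0_poly q j : eval_at q (row0_poly j) = row0 q j.
Proof.
rewrite /row0_poly /row0 /qentry; case: insub => [p|]; first exact: eval_at_var.
by rewrite insubF ?ltn0 // /eval_at meval1.
Qed.

Definition coord_poly (j : 'I_n.+1) : mpoly n C :=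
  if unlift ord0 j is Some i then mvar i else 1.

Lemma eval_coord_poly q j : meval (coords q) (coord_poly j) = row0 q j.
Proof.
rewrite /coord_poly; case: unliftP => [i ->|->]; first by rewrite mevalXU.
by rewrite meval1 /row0 qentry_diag.
Qed.

Lemma row0_neq0 q j : torus q -> row0 q j != 0.
Proof. exact: qentry_neq0. Qed.

(** On the coset q_ab = c_ab t_b / t_a, so that f becomes a Laurent polynomial
h / g in the coordinates t_j, with a monomial g; allowing any g without zeros on
the coset, the functions with such a presentation form a ring. *)
Lemma restrict_to_coset c (f : mpoly #|pair_index n| C) :
  exists g h : mpoly n C, forall q, coset_torus c q ->
    meval (coords q) g != 0 /\
    meval (coords q) h = meval (coords q) g * eval_at q f.
Proof.
pose L f := exists g h : mpoly n C, forall q, coset_torus c q ->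
    meval (coords q) g != 0 /\
    meval (coords q) h = meval (coords q) g * eval_at q f.
have LC a : L (mpolyC _ a).
  exists 1, (mpolyC _ a) => q _; rewrite meval1 oner_neq0; split=> //.
  by rewrite /eval_at !mevalC mul1r.
have LD f1 f2 : L f1 -> L f2 -> L (f1 + f2).
  move=> [g1 [h1 L1]] [g2 [h2 L2]].
  exists (g1 * g2), (h1 * g2 + h2 * g1) => q qc.
  have [g10 e1] := L1 q qc; have [g20 e2] := L2 q qc.
  rewrite !mevalM mevalD !mevalM mulf_neq0 //; split=> //.
  by rewrite e1 e2 /eval_at mevalD; ring.
have LM f1 f2 : L f1 -> L f2 -> L (f1 * f2).
  move=> [g1 [h1 L1]] [g2 [h2 L2]]; exists (g1 * g2), (h1 * h2) => q qc.
  have [g10 e1] := L1 q qc; have [g20 e2] := L2 q qc.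
  rewrite !mevalM mulf_neq0 //; split=> //.
  by rewrite e1 e2 /eval_at mevalM; ring.
have LX k : L (mvar k).
  pose p := enum_val k.
  exists (coord_poly (val p).1), (mpolyC _ (c p) * coord_poly (val p).2).
  move=> q [tq qc]; rewrite mevalM mevalC !eval_coord_poly row0_neq0 //.
  by split=> //; rewrite -qc /eval_at mevalXU.
rewrite -/(L f) [f]mpolyE; apply: (big_ind L) => // [|m _].
  by rewrite -(mpolyC0 _ C).
rewrite -mul_mpolyC; apply: (LM) => //; rewrite mpolyXE_id.
apply: (big_ind L) => // [|k _]; first by rewrite -(mpolyC1 _ C).
elim: (m k) => [|d IH].
  by rewrite expr0 -(mpolyC1 _ C).
by rewrite exprS; apply: LM.
Qed.

Lemma zariski_closed_family (I : Type) (D : set I)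
    (f : I -> mpoly #|pair_index n| C) :
  zariski_closed [set q | torus q /\ forall i, D i -> eval_at q (f i) = 0].
Proof.
exists [set f i | i in D]; apply/seteqP; split=> q [tq fq]; split=> //.
  by move=> _ [i Di <-]; apply: fq.
by move=> i Di; apply: fq; exists i.
Qed.

Lemma zariski_closedI (A B : set (qtuple R n)) :
  zariski_closed A -> zariski_closed B -> zariski_closed (A `&` B).
Proof.
move=> [S ->] [T ->]; exists (S `|` T); apply/seteqP; split=> q.
  by move=> [[tq Sq] [_ Tq]]; split=> // f [/Sq|/Tq].
by move=> [tq STq]; split; split=> // f ?; apply: STq; [left | right].
Qed.

Lemma zariski_closed_hypersurface f :
  zariski_closed [set q | torus q /\ eval_at q f = 0].
Proof.
have := @zariski_closed_family unit setT (fun=> f); congr zariski_closed.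
by apply/seteqP; split=> q [tq fq]; split=> //; apply: fq tt _.
Qed.

Lemma coset_torus_closed c : zariski_closed (coset_torus c).
Proof.
have := @zariski_closed_family (pair_index n) setT (fun p =>
  row0_poly (val p).1 * mvar (enum_rank p) - mpolyC _ (c p) * row0_poly (val p).2).
have E q p : eval_at q (row0_poly (val p).1 * mvar (enum_rank p) -
    mpolyC _ (c p) * row0_poly (val p).2) =
    row0 q (val p).1 * q p - c p * row0 q (val p).2.
  rewrite -(eval_at_var q p) -!eval_row0_poly /eval_at.
  by rewrite mevalB !mevalM mevalC.
congr zariski_closed; apply/seteqP; split=> q [tq fq]; split=> // p.
  by apply/eqP; rewrite -subr_eq0 -E fq.
by move=> _; rewrite E fq subrr.
Qed.

(** Some equation f of Z fails at q; the numerator of the restriction of f to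
the coset has the same zeros on it as f. *)
Lemma separating_coord_poly c (Z : set (qtuple R n)) q :
  zariski_closed Z -> coset_torus c q -> ~ Z q ->
  exists h : mpoly n C,
    (forall r, coset_torus c r -> Z r -> meval (coords r) h = 0) /\
    meval (coords q) h != 0.
Proof.
move=> [S ->] qc nZq.
have [f [Sf /eqP fq]] : exists f, S f /\ eval_at q f <> 0.
  apply: contrapT => no; apply: nZq; split=> [|f Sf]; first exact: qc.1.
  by apply: contrapT => fq; apply: no; exists f.
have [g [h gh]] := restrict_to_coset c f.
exists h; split=> [r rc [_ /(_ f Sf) fr]|].
  by have [_ ->] := gh r rc; rewrite /eval_at fr mulr0.
by have [g0 ->] := gh q qc; rewrite mulf_neq0.
Qed.

(** The polynomials in the coordinates t_j that vanish on the members of the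
chain form a strictly decreasing chain of prime ideals of a polynomial ring in n
variables. *)
Lemma coset_chain_length c (F : nat -> set (qtuple R n)) m :
  (forall i, (i <= m)%N -> irreducible_closed (F i) /\ F i `<=` coset_torus c) ->
  (forall i, (i < m)%N -> F i `<` F i.+1) -> (m <= n)%N.
Proof.
move=> Firr Fsub; rewrite leqNgt; apply/negP => ltnm.
pose P i (h : mpoly n C) := forall q, F i q -> meval (coords q) h = 0.
have le_m i : (i <= n)%N -> (i < m)%N by move=> ?; apply: leq_ltn_trans ltnm.
apply: (@no_long_prime_chain _ n P).
- move=> i ik; have [[Fcl [q0 Fq0] Firi] Fc] := Firr i (leq_trans ik ltnm).
  split.
  + by move=> q _; rewrite meval0.
  + by move=> a b Pa Pb q Fq; rewrite mevalD Pa // Pb // addr0.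
  + by move=> a b Pb q Fq; rewrite mevalM Pb // mulr0.
  + by move=> /(_ q0 Fq0) /eqP; rewrite meval1 oner_eq0.
  move=> a b Pab.
  (* A polynomial in the t_j is one in the q_ab, so that its zero set is Zariski
     closed in the sense in which F i is irreducible. *)
  pose pull (h : mpoly n C) :=
    comp_mpoly [tuple row0_poly (lift ord0 j) | j < n] h.
  have pullE h q : eval_at q (pull h) = meval (coords q) h.
    rewrite /eval_at comp_mpoly_meval; apply: meval_eq => j.
    by rewrite tnth_mktuple -/(eval_at _ _) eval_row0_poly.
  have [q Fq|sub|sub] := Firi _ _ (zariski_closed_hypersurface (pull a))
    (zariski_closed_hypersurface (pull b)).
  + have [tq _] := Fc q Fq.
    have /eqP := Pab q Fq; rewrite mevalM mulf_eq0 -!pullE.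
    by case/orP => /eqP e; [left | right].
  + by left=> q /sub [_]; rewrite pullE.
  + by right=> q /sub [_]; rewrite pullE.
- by move=> i p /le_m /Fsub [sub _] Pp q /sub /Pp.
move=> i /le_m im; have [_ nsub] := Fsub i im.
have [[Fcl _ _] Fc] := Firr i (ltnW im); have [_ Fc1] := Firr i.+1 im.
have [q [Fq nFq]] : exists q, F i.+1 q /\ ~ F i q.
  apply: contrapT => no; apply: nsub => q Fq; apply: contrapT => nFq.
  by apply: no; exists q.
have [h [hF hq]] := separating_coord_poly Fcl (Fc1 q Fq) nFq.
exists h; split=> [r Fr|/(_ q Fq)/eqP]; last by rewrite (negPf hq).
exact: hF (Fc r Fr) Fr.
Qed.

(** * Cosets of the diagonal torus: lower bound for the dimension *)

Definition diag_torus : set (qtuple R n) := coset_torus (fun=> 1).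

(** Adds the entry t_0 = 1 to the coordinates. *)
Definition homogeneous (y : 'I_n -> C) (j : 'I_n.+1) : C :=
  if unlift ord0 j is Some i then y i else 1.

Definition diag_point (y : 'I_n -> C) : qtuple R n :=
  [ffun p => homogeneous y (val p).2 / homogeneous y (val p).1].

Lemma row0_diag_point y j : row0 (diag_point y) j = homogeneous y j.
Proof.
have h0 : homogeneous y ord0 = 1 by rewrite /homogeneous unlift_none.
case: (unliftP ord0 j) => [i ->|->]; last by rewrite h0 /row0 qentry_diag.
by rewrite /row0 /qentry insubT //= /diag_point ffunE /= h0 divr1.
Qed.

Lemma coords_diag_point y : coords (diag_point y) = y.
Proof.
by apply/funext => i; rewrite /coords row0_diag_point /homogeneous liftK.
Qed.

Lemma diag_point_in y : (forall i, y i != 0) -> diag_torus (diag_point y).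
Proof.
move=> y0; have h0 j : homogeneous y j != 0.
  by rewrite /homogeneous; case: unlift => [i|] //; exact: oner_neq0.
split=> p; first by rewrite /diag_point ffunE mulf_neq0 ?invr_eq0.
by rewrite {2}/diag_point ffunE !row0_diag_point mulrC mul1r divfK.
Qed.

(** The i-dimensional subtorus where only t_1, ..., t_i are free. *)
Definition subtorus (i : nat) : set (qtuple R n) :=
  diag_torus `&` [set q | torus q /\
    forall j : 'I_n.+1, (i < j)%N -> row0 q j = 1].

Lemma subtorus_diag_point i y :
  (forall j, y j != 0) -> (forall j : 'I_n, (i <= j)%N -> y j = 1) ->
  subtorus i (diag_point y).
Proof.
move=> y0 y1; have yd := diag_point_in y0; split=> //; split; first exact: yd.1.
move=> j ij; rewrite row0_diag_point /homogeneous.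
by case: unliftP ij => [k ->|->] //= /y1.
Qed.

Lemma subtorus_closed i : zariski_closed (subtorus i).
Proof.
apply: zariski_closedI; first exact: coset_torus_closed.
have := @zariski_closed_family 'I_n.+1 [set j | (i < val j)%N]
  (fun j => row0_poly j - 1).
congr zariski_closed; apply/seteqP; split=> q [tq fq]; split=> // j ij.
  by have /eqP := fq j ij; rewrite /eval_at mevalB meval1 subr_eq0 -/(eval_at _ _)
    eval_row0_poly => /eqP.
by rewrite /eval_at mevalB meval1 -/(eval_at _ _) eval_row0_poly fq // subrr.
Qed.

(** If neither A nor B contains the subtorus, each misses a point x, respectively
z, of it, where a polynomial vanishing on A, respectively B, is nonzero.  Some
point of the line through x and z is in the torus and is a zero of neither
polynomial; the line stays in the subtorus because its equations t_j = 1 are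
affine. *)
Lemma subtorus_irreducible i : irreducible_closed (subtorus i).
Proof.
split; first exact: subtorus_closed.
  exists (diag_point (fun=> 1)); apply: subtorus_diag_point => // _.
  exact: oner_neq0.
move=> A B Acl Bcl sub.
have escape Z : zariski_closed Z -> ~ subtorus i `<=` Z ->
    exists x h, [/\ subtorus i x, meval (coords x) h != 0 &
      forall r, diag_torus r -> Z r -> meval (coords r) h = 0].
  move=> Zcl nsub; have [x [xi nZx]] : exists x, subtorus i x /\ ~ Z x.
    apply: contrapT => no; apply: nsub => x xi; apply: contrapT => nZx.
    by apply: no; exists x.
  have [h [hZ hx]] := separating_coord_poly Zcl xi.1 nZx.
  by exists x, h; split.
apply: contrapT => /not_orP [/(escape _ Acl) [x [g [xi gx gA]]]].
move=> /(escape _ Bcl) [z [h [zi hz hB]]].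
(* Multiplying by m makes the line avoid the coordinate hyperplanes too. *)
pose m : mpoly n C := \prod_(j < n) mvar j.
have m_neq0 y : meval y m != 0 <-> forall j, y j != 0.
  rewrite /m rmorph_prod /=; split=> [/prodf_neq0 y0 j|y0].
    by have := y0 j isT; rewrite mevalXU.
  by apply/prodf_neq0 => j _; rewrite mevalXU.
have coords_m q : torus q -> meval (coords q) m != 0.
  by move=> tq; apply/m_neq0 => j; apply: row0_neq0.
have [] := @line_avoids_zeros _ n (g * m) (h * m) (coords x) (coords z).
- by rewrite mevalM mulf_neq0 // coords_m //; exact: xi.1.1.
- by rewrite mevalM mulf_neq0 // coords_m //; exact: zi.1.1.
move=> s; set w := fun _ => _; rewrite !mevalM !mulf_eq0 !negb_or.
move=> [/andP [gw /m_neq0 w0] /andP [hw _]].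
have wi : subtorus i (diag_point w).
  apply: subtorus_diag_point => // j ij; rewrite /w.
  by rewrite /coords xi.2.2 ?zi.2.2 // subrr mulr0 addr0.
case: (sub _ wi) => [/(gA _ wi.1)|/(hB _ wi.1)]; rewrite coords_diag_point => /eqP.
  by rewrite (negPf gw).
by rewrite (negPf hw).
Qed.

Lemma diag_torus_chain : has_chain diag_torus n.
Proof.
exists subtorus; split=> [i _|i ltin].
  by split; [exact: subtorus_irreducible | move=> q []].
split=> [q [qd [tq q1]]|sub].
  by split=> //; split=> // j ij; apply: q1; apply: ltnW.
pose y (j : 'I_n) : C := if val j == i then -1 else 1.
have yi : subtorus i.+1 (diag_point y).
  apply: subtorus_diag_point => j; rewrite /y.
    by case: ifP; rewrite ?oppr_eq0 oner_neq0.
  by case: eqP => // ->; rewrite ltnn.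
have [_ [_ /(_ (lift ord0 (Ordinal ltin)))]] := sub _ yi.
rewrite row0_diag_point /homogeneous liftK /y eqxx => /(_ (ltnSn _)) /eqP.
by rewrite eq_sym -subr_eq0 opprK -mulr2n pnatr_eq0.
Qed.

(** The top member of a chain in Z is irreducible, so it lies in one of the two
cosets, and the whole chain with it. *)
Lemma has_dim_two_cosets (Z : set (qtuple R n)) c1 c2 :
  diag_torus `<=` Z -> Z `<=` coset_torus c1 `|` coset_torus c2 ->
  has_dim Z n.
Proof.
move=> dZ Zc; split.
  have [F [Firr Fsub]] := diag_torus_chain; exists F; split=> // i /Firr [? Fd].
  by split=> // q /Fd /dZ.
move=> m [F [Firr Fsub]].
have Fm i : (i <= m)%N -> F i `<=` F m.
  elim: m Fsub {Firr} => [|m IH] Fsub; first by rewrite leqn0 => /eqP ->.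
  rewrite leq_eqVlt => /predU1P [-> //|]; rewrite ltnS => im q Fq.
  have [sub _] := Fsub m (ltnSn m); apply: sub; apply: IH => // j jm.
  by apply: Fsub; apply: leqW.
have [[_ _ Fm_irr] FmZ] := Firr m (leqnn m).
have [c Fmc] : exists c, F m `<=` coset_torus c.
  have [q Fq|?|?] := Fm_irr _ _ (coset_torus_closed c1) (coset_torus_closed c2).
  - exact/Zc/FmZ.
  - by exists c1.
  - by exists c2.
apply: (coset_chain_length (c := c) _ Fsub) => i im; have [Fi _] := Firr i im.
by split=> // q /(Fm i im) /Fmc.
Qed.

(** * The variety of the full simplex and the action of permutations *)

Lemma qentry_diag_torus q a b :
  diag_torus q -> qentry q a b = row0 q b / row0 q a.
Proof.
move=> [tq qd].
have lt_case (i j : 'I_n.+1) : (i < j)%N -> qentry q i j = row0 q j / row0 q i.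
  move=> ij; pose p : pair_index n := Sub (i, j) ij.
  by rewrite -[row0 q j]mul1r -(qd p) -qentry_pair mulrAC divff ?mul1r ?row0_neq0.
have [ab|ba|/val_inj ->] := ltngtP (val a) (val b); first exact: lt_case.
  by rewrite qentry_sym lt_case // invf_div.
by rewrite qentry_diag divff // row0_neq0.
Qed.

Lemma VJ_full : VJ R [set: triple_index n]%SET = diag_torus.
Proof.
apply/seteqP; split=> q [tq bq]; split=> //.
  move=> p; rewrite mul1r -qentry_pair; case: p => [[a b] ab] /=.
  have [a0|a0] := posnP (val a).
    by rewrite (_ : a = ord0) ?[row0 q ord0]qentry_diag ?mul1r //; apply: val_inj.
  pose t := (ord0 : 'I_n.+1, a : 'I_n.+1, b : 'I_n.+1).
  have t_lt : (t.1.1 < t.1.2 < t.2)%N by rewrite /= a0.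
  have /eqP := bq (Sub t t_lt) (finset.in_setT _).
  rewrite subr_eq0 /bfun /= => /eqP /(congr1 ( *%R^~ (row0 q b))).
  by rewrite divfK ?row0_neq0 // mul1r.
move=> t _; rewrite /bfun; case: (val t) => [[i j] k].
rewrite !qentry_diag_torus //; field.
by rewrite !row0_neq0.
Qed.

Lemma qentry_permute (s : 'S_n.+1) q i j :
  qentry (permute s q) i j = qentry q (s i) (s j).
Proof.
have lt_case (a b : 'I_n.+1) : (a < b)%N ->
    qentry (permute s q) a b = qentry q (s a) (s b).
  move=> ab; pose p : pair_index n := Sub (a, b) ab.
  by rewrite -[LHS]/(qentry _ (val p).1 (val p).2) qentry_pair /permute ffunE.
have [ij|ji|/val_inj ->] := ltngtP (val i) (val j); first exact: lt_case.
  by rewrite qentry_sym lt_case // -qentry_sym.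
by rewrite !qentry_diag.
Qed.

Lemma permute1 q : permute 1 q = q.
Proof. by apply/ffunP => p; rewrite /permute ffunE !perm1 qentry_pair. Qed.

End Torus.

(** * The 6-vertex projective plane *)

(** The quotient of the icosahedron by the antipodal map.  The link of the vertex
0 is the pentagon 1, 2, 3, 4, 5, and the other five triangles are
i, i+1, i+3 for i in this cyclic order. *)
Definition rp2_triangles : seq (nat * nat * nat) :=
  [:: (0, 1, 2); (0, 2, 3); (0, 3, 4); (0, 4, 5); (0, 1, 5);
      (1, 2, 4); (2, 3, 5); (1, 3, 4); (2, 4, 5); (1, 3, 5)]%N.

(** The five edges outside the closed star of the vertex 0: the 1-cocycle taking
the value -1 on them and 1 elsewhere represents the nontrivial class of the
projective plane. *)
Definition rp2_cut : seq (nat * nat) :=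
  [:: (1, 3); (1, 4); (2, 4); (2, 5); (3, 5)]%N.

Definition rp2 : {set triple_index 5} :=
  finset (fun t => (val (val t).1.1, val (val t).1.2, val (val t).2)
                     \in rp2_triangles).

(** Measured against the coboundary of t_a = Q 0 a, a cocycle is 1 on the edges
in the closed star of the vertex 0.  Four of the remaining triangles force the five
edges of [rp2_cut] to have a common value z, and the triangle 1, 3, 5, with two
of these edges, gives z ^+ 2 = 1. *)
Lemma rp2_cocycle (F : fieldType) (Q : nat -> nat -> F) :
  (forall a b, Q a b != 0) -> (forall a, Q a a = 1) ->
  (forall a b c, (a, b, c) \in rp2_triangles -> Q a b * Q b c = Q a c) ->
  exists z, z ^+ 2 = 1 /\ forall a b, (a < b < 6)%N ->
    Q 0%N a * Q a b = (if (a, b) \in rp2_cut then z else 1) * Q 0%N b.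
Proof.
move=> Q0 Q1 Qt.
have div a b c : (a, b, c) \in rp2_triangles -> Q b c = Q a c / Q a b.
  by move=> /Qt <-; rewrite mulrC mulKf.
have Q13 : Q 1%N 3%N = Q 0%N 1%N * Q 1%N 3%N / Q 0%N 3%N * (Q 0%N 3%N / Q 0%N 1%N).
  by field; rewrite !Q0.
move: Q13; set z := _ / Q 0%N 3%N => Q13; exists z.
have Q12 : Q 1%N 2%N = Q 0%N 2%N / Q 0%N 1%N by apply: div.
have Q23 : Q 2%N 3%N = Q 0%N 3%N / Q 0%N 2%N by apply: div.
have Q34 : Q 3%N 4%N = Q 0%N 4%N / Q 0%N 3%N by apply: div.
have Q45 : Q 4%N 5%N = Q 0%N 5%N / Q 0%N 4%N by apply: div.
have Q15 : Q 1%N 5%N = Q 0%N 5%N / Q 0%N 1%N by apply: div.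
have Q14 : Q 1%N 4%N = z * (Q 0%N 4%N / Q 0%N 1%N).
  by rewrite -(Qt 1 3 4)%N // Q13 Q34; field; rewrite !Q0.
have Q24 : Q 2%N 4%N = z * (Q 0%N 4%N / Q 0%N 2%N).
  by rewrite (div 1 2 4)%N // Q14 Q12; field; rewrite !Q0.
have Q25 : Q 2%N 5%N = z * (Q 0%N 5%N / Q 0%N 2%N).
  by rewrite -(Qt 2 4 5)%N // Q24 Q45; field; rewrite !Q0.
have Q35 : Q 3%N 5%N = z * (Q 0%N 5%N / Q 0%N 3%N).
  by rewrite (div 2 3 5)%N // Q25 Q23; field; rewrite !Q0.
have Q135 := Qt 1%N 3%N 5%N isT; rewrite Q13 Q35 Q15 in Q135.
clearbody z; split.
  have u0 : Q 0%N 5%N / Q 0%N 1%N != 0 by rewrite mulf_neq0 ?invr_eq0.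
  apply: (mulIf u0); rewrite mul1r -[RHS]Q135.
  by field; rewrite !Q0.
move=> a b /andP [ab b6].
have : (a, b) \in [seq (i, j) | j <- iota 0 6, i <- iota 0 j].
  by apply/allpairsPdep; exists b, a; rewrite !mem_iota.
rewrite /= !inE.
by do 14?[case/orP]; move=> /eqP [-> ->] /=;
  rewrite ?Q1 ?Q12 ?Q13 ?Q14 ?Q15 ?Q23 ?Q24 ?Q25 ?Q34 ?Q35 ?Q45; field; rewrite ?Q0.
Qed.

Section ProjectivePlane.

Variable R : realType.
Local Notation C := R[i].

Definition twist (z : C) (p : pair_index 5) : C :=
  if (val (val p).1, val (val p).2) \in rp2_cut then z else 1.

(** A point of V(J) is a 1-cocycle, and the number z of [rp2_cocycle] is a sign;
it tells in which coset the point lies. *)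
Lemma VJ_rp2_sub :
  VJ R rp2 `<=` coset_torus (twist 1) `|` coset_torus (twist (-1)).
Proof.
move=> q [tq bq].
pose Q a b := qentry q (inord a : 'I_6) (inord b).
have Qt a b c : (a, b, c) \in rp2_triangles -> Q a b * Q b c = Q a c.
  move=> abc.
  have lt_abc : (a < b < c)%N && (c < 6)%N.
    have /allP /(_ _ abc) // : all (fun t => (t.1.1 < t.1.2 < t.2) && (t.2 < 6))%N
      rp2_triangles by [].
  have /and3P [ab bc c6] : [&& a < b, b < c & c < 6]%N by rewrite andbA.
  pose t := (inord a : 'I_6, inord b : 'I_6, inord c : 'I_6).
  have t_lt : (t.1.1 < t.1.2 < t.2)%N by rewrite /= !inordK //; lia.
  have /eqP : Q a b * Q b c * (Q a c)^-1 - 1 = 0.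
    by apply: (bq (Sub t t_lt)); rewrite inE /= !inordK //; lia.
  rewrite subr_eq0 => /eqP.
  move/(congr1 ( *%R^~ (Q a c))).
  by rewrite divfK ?mul1r // /Q qentry_neq0.
have [||z [z2 zP]] := rp2_cocycle _ _ Qt.
- by move=> a b; apply: qentry_neq0.
- by move=> a; apply: qentry_diag.
have inord0 : inord 0 = ord0 :> 'I_6 by apply: val_inj; rewrite /= inordK.
have qz : coset_torus (twist z) q.
  split=> // p; have := zP (val (val p).1) (val (val p).2).
  rewrite /Q !inord_val inord0 qentry_pair; apply.
  by rewrite (valP p) ltn_ord.
have /orP [/eqP <-|/eqP <-] : (z == 1) || (z == -1).
  by rewrite -sqrf_eq1 z2.
  by left.
by right.
Qed.

Definition sign_point : qtuple R 5 := [ffun p => twist (-1) p].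

Lemma qentry_sign_point (i j : 'I_6) : (i < j)%N ->
  qentry sign_point i j = if (i : nat, j : nat) \in rp2_cut then -1 else 1.
Proof.
move=> ij; pose p : pair_index 5 := Sub (i, j) ij.
by rewrite -[LHS]/(qentry _ (val p).1 (val p).2) qentry_pair /sign_point ffunE.
Qed.

Lemma sign_point_in_VJ : VJ R rp2 sign_point.
Proof.
split=> [p|t].
  by rewrite /sign_point ffunE /twist; case: ifP; rewrite ?oppr_eq0 oner_neq0.
rewrite inE /bfun; have := valP t; case: (val t) => [[i j] k] /= /andP [ij jk].
rewrite !qentry_sign_point //; last exact: ltn_trans jk.
rewrite !inE; do 9?[case/orP]; move=> /eqP [-> -> ->] /=;
by rewrite ?mulrNN ?mul1r ?mulr1 ?invr1 ?invrN1 ?mulrNN ?mul1r ?mulr1 subrr.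
Qed.

(** If the nodes were equal, the sign cocycle would be a permuted point of the
torus q_ab = t_b / t_a.  Such points satisfy the cocycle equation on all triples
of vertices, but the sign cocycle violates it on 0, 1, 3. *)
Lemma nodes_neq : node_of R [set: triple_index 5]%SET <> node_of R rp2.
Proof.
move=> nodeE.
have : node_of R [set: triple_index 5]%SET (VJ R rp2).
  rewrite nodeE; exists 1%g; apply/seteqP; split=> [q qJ|_ [q qJ <-]].
    by exists q => //; rewrite permute1.
  by rewrite permute1.
rewrite /node_of VJ_full => -[s VE].
have := sign_point_in_VJ; rewrite VE => -[q qd /(congr1 (fun q => qentry q)) qE].
have cocycle (i j k : 'I_6) : qentry sign_point i j * qentry sign_point j k =
    qentry sign_point i k.
  rewrite -qE !qentry_permute !qentry_diag_torus // mulrC.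
  by rewrite mulrA divfK // row0_neq0 //; exact: qd.1.
have := cocycle ord0 (@Ordinal 6 1 isT) (@Ordinal 6 3 isT).
rewrite !qentry_sign_point //= mul1r => /eqP.
by rewrite eq_sym -subr_eq0 opprK -mulr2n pnatr_eq0.
Qed.

End ProjectivePlane.

Theorem theorem8 (R : realType) :
  exists N1 N2 : set (set (qtuple R 5)),
    [/\ end_point N1, end_point N2 & N1 <> N2].
Proof.
exists (node_of R [set: triple_index 5]%SET), (node_of R rp2); split.
- exists [set: triple_index 5]%SET; split=> //; rewrite VJ_full.
  by apply: (has_dim_two_cosets (c1 := fun=> 1) (c2 := fun=> 1)) => // q; left.
- exists rp2; split=> //; apply: has_dim_two_cosets (@VJ_rp2_sub R) => q.
  by rewrite -VJ_full => -[tq bq]; split=> // t _; apply: bq; rewrite finset.in_setT.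
exact: nodes_neq.
Qed.
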